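(* $\mathsf{ICM}$ has the amalgamation property: for all $\mathbf A,\mathbf B,\mathbf C\in\mathsf{ICM}$ and embeddings $h_1:\mathbf A\to\mathbf B$, $h_2:\mathbf A\to\mathbf C$, there exist $\mathbf D\in\mathsf{ICM}$ and embeddings $g_1:\mathbf B\to\mathbf D$, $g_2:\mathbf C\to\mathbf D$ with $g_1\circ h_1=g_2\circ h_2$.
   Context: A field is weakly rooted if it has characteristic $0$, or has prime characteristic $p$ and every element has a $p$-th root. Weak inverse: $a^*=a^{-1}$ if $a\ne0$, $0^*=0$. Weak $p$-root (in a weakly rooted field, $p$ prime): $r_p(a)=\sqrt[p]{a}$ if the characteristic is $p$, and $0$ otherwise. An implicitly closed field is a weakly rooted field (ring language $\{+,\cdot,-,0,1\}$) expanded by $(\,)^*$ and all $r_p$. $\mathsf{ICM}$ is the class of algebras in this language isomorphic to subalgebras of direct products of implicitly closed fields; embeddings are injective homomorphisms in this language. *)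

(* Defs.v *)
From HB Require Import structures.
From mathcomp Require Import all_boot all_algebra.
Set Implicit Arguments. Unset Strict Implicit. Unset Printing Implicit Defensive.
Import GRing.Theory.
Local Open Scope ring_scope.

(* Algebras in the language {+, *, -, 0, 1, ( )^*, r_p (p prime)}.
   The weak p-roots are given as one operation indexed by nat; only
   the indices p with [prime p] are part of the language. *)
Record Alg := {
  carrier :> Type;
  a_add : carrier -> carrier -> carrier;
  a_mul : carrier -> carrier -> carrier;
  a_opp : carrier -> carrier;
  a_zero : carrier;
  a_one : carrier;
  a_winv : carrier -> carrier;
  a_root : nat -> carrier -> carrier }.

Definition is_hom (A B : Alg) (f : A -> B) : Prop :=
  (forall x y, f (a_add x y) = a_add (f x) (f y)) /\
  (forall x y, f (a_mul x y) = a_mul (f x) (f y)) /\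
  (forall x, f (a_opp x) = a_opp (f x)) /\
  f (a_zero A) = a_zero B /\
  f (a_one A) = a_one B /\
  (forall x, f (a_winv x) = a_winv (f x)) /\
  (forall p x, prime p -> f (a_root p x) = a_root p (f x)).

Definition embedding (A B : Alg) (f : A -> B) : Prop :=
  is_hom f /\ injective f.

Definition weakly_rooted (F : fieldType) : Prop :=
  [pchar F] =i pred0 \/
  exists p, p \in [pchar F] /\ forall a : F, exists b : F, b ^+ p = a.

(* An implicitly closed field: a weakly rooted field with its weak p-roots.
   The weak inverse is the MathComp field inverse (which sends 0 to 0). *)
Record ICField := {
  icf_field : fieldType;
  icf_root : nat -> icf_field -> icf_field;
  icf_wr : weakly_rooted icf_field;
  icf_root_char : forall p a, prime p -> p \in [pchar icf_field] ->
                    icf_root p a ^+ p = a;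
  icf_root_other : forall p a, prime p -> p \notin [pchar icf_field] ->
                    icf_root p a = 0 }.

Definition prod_alg (I : Type) (F : I -> ICField) : Alg := {|
  carrier := forall i, icf_field (F i);
  a_add := fun x y i => x i + y i;
  a_mul := fun x y i => x i * y i;
  a_opp := fun x i => - x i;
  a_zero := fun i => 0;
  a_one := fun i => 1;
  a_winv := fun x i => (x i)^-1;
  a_root := fun p x i => @icf_root (F i) p (x i) |}.

Definition ICM (A : Alg) : Prop :=
  exists (I : Type) (F : I -> ICField) (h : A -> prod_alg F), embedding h.

(* Main.v *)
Require Import Defs.
From HB Require Import structures.
From mathcomp Require Import all_boot all_algebra.
From mathcomp Require Import boolp classical_sets.
From mathcomp Require Import ring.
Set Implicit Arguments. Unset Strict Implicit. Unset Printing Implicit Defensive.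
Import GRing.Theory.
Local Open Scope classical_set_scope.
Local Open Scope ring_scope.

(** For points [x <> y] of [B], choose a homomorphism [f] from [B] to an
    implicitly closed field [F] that separates them; put [phi = f \o h1].  The
    amalgam is a product, over all such pairs (from [B] or from [C]), of fields
    that receive [F] and [C] compatibly over [A].

    Such a field is a residue field of [F (x)_A C], realised as a ring of
    operators: on the [A]-linear maps [C -> F], the field [F] acts by
    post-multiplication, [C] by pre-multiplication, and these actions commute
    and agree on [A].  This ring is nontrivial because [a |-> phi a] extends, by
    Zorn's lemma, from [A] to an [A]-linear map on [C].  A residue field [L] is
    generated by the images of [F] and [C], whose elements have [p]-th roots in
    [L] when [L] has characteristic [p]; hence [L] is perfect.  Weak inverses
    and weak roots are preserved by any ring homomorphism into such an [L],
    since they are determined by equations. *)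

(** * Quotients that are fields *)

(** The laws are asked only up to [r]: on formal terms they hold only modulo an ideal. *)
Record field_congruence (T : Type) (zero one : T) (add mul : T -> T -> T)
    (opp : T -> T) (r : T -> T -> Prop) : Prop := FieldCongruence {
  fc_refl : forall x, r x x;
  fc_sym : forall x y, r x y -> r y x;
  fc_trans : forall x y z, r x y -> r y z -> r x z;
  fc_add : forall x x' y y', r x x' -> r y y' -> r (add x y) (add x' y');
  fc_mul : forall x x' y y', r x x' -> r y y' -> r (mul x y) (mul x' y');
  fc_addA : forall x y z, r (add x (add y z)) (add (add x y) z);
  fc_addC : forall x y, r (add x y) (add y x);
  fc_add0 : forall x, r (add zero x) x;
  fc_addN : forall x, r (add (opp x) x) zero;
  fc_mulA : forall x y z, r (mul x (mul y z)) (mul (mul x y) z);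
  fc_mulC : forall x y, r (mul x y) (mul y x);
  fc_mul1 : forall x, r (mul one x) x;
  fc_mulD : forall x y z, r (mul (add x y) z) (add (mul x z) (mul y z));
  fc_one_zero : ~ r one zero;
  fc_inv : forall x, ~ r x zero -> exists y, r (mul y x) one }.

(** Classes are the predicates [r x], which extensionality makes equal exactly for related points;
    operations go through chosen representatives. *)
Lemma field_congruence_quotient T zero one add mul opp r :
  @field_congruence T zero one add mul opp r ->
  exists (K : fieldType) (pi : T -> K),
    [/\ forall k, exists x, pi x = k,
        forall x y, r x y -> pi x = pi y,
        forall x y, pi (add x y) = pi x + pi y,
        forall x y, pi (mul x y) = pi x * pi y &
        pi one = 1].
Proof.
move=> C.
pose Q := {P : T -> Prop | exists x, P = r x}.
pose pi x : Q := exist _ (r x) (ex_intro _ x erefl).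
have piE x y : r x y -> pi x = pi y.
  move=> rxy; apply: eq_exist; apply/funext => z; apply/propext; split.
    by apply: (fc_trans C); apply: (fc_sym C).
  exact: (fc_trans C).
have piI x y : pi x = pi y -> r x y.
  by move=> /(congr1 sval) /= ->; apply: (fc_refl C).
have piS (k : Q) : exists x, pi x = k.
  by case: k => P [x ePx]; exists x; apply: eq_exist.
have [rep repK] := choice piS.
pose addQ a b := pi (add (rep a) (rep b)).
pose mulQ a b := pi (mul (rep a) (rep b)).
pose oppQ a := pi (opp (rep a)).
have rpi x : r (rep (pi x)) x by apply: piI.
have addE x y : addQ (pi x) (pi y) = pi (add x y) by apply/piE/(fc_add C).
have mulE x y : mulQ (pi x) (pi y) = pi (mul x y) by apply/piE/(fc_mul C).
have ind1 (P : Q -> Prop) : (forall x, P (pi x)) -> forall k, P k.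
  by move=> HP k; have [x <-] := piS k.
have addA : associative addQ.
  by do 3![elim/ind1 => ?]; rewrite !addE; apply/piE/(fc_addA C).
have addC : commutative addQ.
  by do 2![elim/ind1 => ?]; rewrite !addE; apply/piE/(fc_addC C).
have add0 : left_id (pi zero) addQ.
  by elim/ind1 => ?; rewrite addE; apply/piE/(fc_add0 C).
have addN : left_inverse (pi zero) oppQ addQ.
  by move=> k; rewrite /oppQ -{2}(repK k) addE; apply/piE/(fc_addN C).
have mulA : associative mulQ.
  by do 3![elim/ind1 => ?]; rewrite !mulE; apply/piE/(fc_mulA C).
have mulC : commutative mulQ.
  by do 2![elim/ind1 => ?]; rewrite !mulE; apply/piE/(fc_mulC C).
have mul1 : left_id (pi one) mulQ.
  by elim/ind1 => ?; rewrite mulE; apply/piE/(fc_mul1 C).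
have mulD : left_distributive mulQ addQ.
  by do 3![elim/ind1 => ?]; rewrite !(addE, mulE); apply/piE/(fc_mulD C).
(* A field structure has a total inverse, so the choice also fixes the value zero at the zero
   class. *)
have invS (k : Q) : exists l, if `[< k = pi zero >] then l = pi zero
                              else mulQ l k = pi one.
  case: asboolP => [_|]; first by exists (pi zero).
  elim/ind1: k => x x0.
  have /(fc_inv C)[y yx] : ~ r x zero by move=> /piE.
  by exists (pi y); rewrite mulE; apply: piE.
have [inv invE] := choice invS.
pose Qc : choiceType := HB.pack Q (gen_eqMixin Q) (gen_choiceMixin Q).
have nz1 : (pi one : Qc) != pi zero.
  by apply/eqP => /piI; apply: (fc_one_zero C).
pose Qz : zmodType :=
  HB.pack Qc (GRing.isZmodule.Build Qc addA addC add0 addN).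
pose Qr : comNzRingType :=
  HB.pack Qz (GRing.Zmodule_isComNzRing.Build Qz mulA mulC mul1 mulD nz1).
have invr (x : Qr) : x != 0 -> (inv x : Qr) * x = 1.
  by move=> /eqP x0; have := invE x; case: asboolP.
have inv0 : (inv (0 : Qr) : Qr) = 0.
  by have := invE (0 : Qr); case: asboolP.
pose Qf : fieldType := HB.pack Qr (GRing.ComNzRing_isField.Build Qr invr inv0).
by exists Qf, pi; split.
Qed.

(** * Zorn's lemma above a given set *)

(** Zorn's lemma is applied to the sets whose union with [X0] satisfies [P]. *)
Lemma Zorn_above (T : Type) (P : set (set T)) (X0 : set T) : P X0 ->
  (forall F : set (set T), F X0 -> F `<=` P -> total_on F subset ->
     P (\bigcup_(X in F) X)) ->
  exists M, [/\ P M, X0 `<=` M & forall B, P B -> M `<=` B -> B `<=` M].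
Proof.
move=> PX0 Pchain.
have [F FP Ftot|A [PA maxA]] := @Zorn_bigcup T [set X | P (X `|` X0)].
  (* Adjoining [X0] itself keeps the family nonempty when [F] is the empty chain. *)
  pose G : set (set T) := [set Y | Y = X0 \/ exists2 X, F X & Y = X `|` X0].
  rewrite /= (_ : _ `|` _ = \bigcup_(Y in G) Y).
    apply: Pchain; first by left.
      by move=> _ [->//|[X FX ->]]; apply: FP.
    move=> _ _ [->|[X FX ->]] [->|[Y FY ->]];
      [by left|by left; right|by right; right|].
    have [XY|YX] := Ftot _ _ FX FY; [left|right];
      (by move=> z [?|?]; [left; auto|right]).
  apply/seteqP; split=> [z [[X FX Xz]|X0z]|z [_ [->|[X FX ->]]]].
  - by exists (X `|` X0); [right; exists X|left].
  - by exists X0; [left|].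
  - by right.
  - by case=> ?; [left; exists X|right].
exists (A `|` X0); split=> // B PB AB.
apply: contrapT => nBA; apply: (maxA B).
  split=> [x Ax|BA]; first by apply: AB; left.
  by apply: nBA => x /BA; left.
rewrite /= (_ : _ `|` _ = B)//; apply/seteqP; split=> x; last by left.
by case=> // X0x; apply: AB; right.
Qed.

(** * Homomorphisms from algebras in [ICM] to fields *)

Definition field_alg (F : ICField) : Alg := {|
  carrier := icf_field F;
  a_add := fun x y => x + y;
  a_mul := fun x y => x * y;
  a_opp := fun x => - x;
  a_zero := 0;
  a_one := 1;
  a_winv := fun x => x^-1;
  a_root := @icf_root F |}.

Lemma is_hom_comp (A B C : Alg) (f : A -> B) (g : B -> C) :
  is_hom f -> is_hom g -> is_hom (g \o f).
Proof.
move=> [fD [fM [fN [f0 [f1 [fV fR]]]]]] [gD [gM [gN [g0 [g1 [gV gR]]]]]].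
do 6?split=> [*|]; rewrite /= ?(fD, fM, fN, f0, f1, fV) ?(gD, gM, gN, g0, g1, gV)//.
by move=> *; rewrite fR// gR.
Qed.

Lemma is_hom_proj (I : Type) (F : I -> ICField) (i : I) :
  is_hom (fun x : prod_alg F => x i : field_alg (F i)).
Proof. by []. Qed.

Lemma ICM_prod (I : Type) (F : I -> ICField) : ICM (prod_alg F).
Proof. by exists I, F, id; split. Qed.

Lemma ICM_field (F : ICField) : ICM (field_alg F).
Proof.
exists unit, (fun=> F), (fun x _ => x); split=> // x y.
by move=> /(congr1 (fun f => f tt)).
Qed.

(** The coordinates of an embedding into a product separate points. Equations in [A] can thus be
    checked in fields, with [ring] and case splits on zero. *)
Lemma ICM_separated (A : Alg) (x y : A) : ICM A ->
  (forall (F : ICField) (f : A -> field_alg F), is_hom f -> f x = f y) -> x = y.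
Proof.
move=> [I [F [e [he inj]]]] H; apply/inj/functional_extensionality_dep => i.
exact: (H _ _ (is_hom_comp he (is_hom_proj F i))).
Qed.

(** For a source in [ICM], preservation of the other operations is deduced from these three
    clauses. *)
Definition ring_hom (A : Alg) (K : fieldType) (f : A -> K) : Prop :=
  [/\ forall x y, f (a_add x y) = f x + f y,
      forall x y, f (a_mul x y) = f x * f y & f (a_one A) = 1].

Section HomToField.
Variables (A : Alg) (F : ICField) (f : A -> field_alg F) (hf : is_hom f).
Let K : fieldType := icf_field F.

Lemma homD x y : f (a_add x y) = (f x : K) + f y. Proof. exact: hf.1. Qed.
Lemma homM x y : f (a_mul x y) = (f x : K) * f y. Proof. exact: hf.2.1. Qed.
Lemma homN x : f (a_opp x) = - (f x : K). Proof. exact: hf.2.2.1. Qed.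
Lemma hom0 : f (a_zero A) = 0 :> K. Proof. exact: hf.2.2.2.1. Qed.
Lemma hom1 : f (a_one A) = 1 :> K. Proof. exact: hf.2.2.2.2.1. Qed.
Lemma homV x : f (a_winv x) = (f x : K)^-1.
Proof. exact: hf.2.2.2.2.2.1. Qed.
Lemma homR p x : prime p -> f (a_root p x) = icf_root p (f x : K).
Proof. exact: hf.2.2.2.2.2.2. Qed.

Lemma is_hom_ring_hom : ring_hom (f : A -> K).
Proof. by split; [exact: homD|exact: homM|exact: hom1]. Qed.

Definition homE := (homD, homM, homN, hom0, hom1, homV).
End HomToField.

Definition a_nat (A : Alg) n : A := iter n (a_add (a_one A)) (a_zero A).
Definition a_exp (A : Alg) (x : A) n : A := iter n (a_mul x) (a_one A).

Lemma is_hom_prod (I : Type) (F : I -> ICField) (A : Alg)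
    (f : forall i, A -> field_alg (F i)) :
  (forall i, is_hom (f i)) -> is_hom (fun x => (fun i => f i x) : prod_alg F).
Proof.
move=> hf; have ext (x y : prod_alg F) : (forall i, x i = y i) -> x = y.
  exact: functional_extensionality_dep.
do 6?split=> [*|]; try (apply: ext => i; rewrite ?(homE (hf i))//).
by move=> p x p_prime; apply: ext => i; rewrite (homR (hf i)).
Qed.

(** * Weak inverses and weak roots are determined by equations *)

Section RingHom.
Variables (A : Alg) (K : fieldType) (g : A -> K).
Hypotheses (AICM : ICM A) (hg : ring_hom g).

Let gD x y : g (a_add x y) = g x + g y. Proof. by case: hg. Qed.
Let gM x y : g (a_mul x y) = g x * g y. Proof. by case: hg. Qed.
Let g1 : g (a_one A) = 1. Proof. by case: hg. Qed.

Lemma ring_hom0 : g (a_zero A) = 0.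
Proof.
apply: (addrI (g (a_zero A))); rewrite -gD addr0; congr g.
by apply: ICM_separated => // F f hf; rewrite !(homE hf) addr0.
Qed.

Lemma ring_homN x : g (a_opp x) = - g x.
Proof.
apply: (addrI (g x)); rewrite -gD subrr -ring_hom0; congr g.
by apply: ICM_separated => // F f hf; rewrite !(homE hf) subrr.
Qed.

(** The equations [x y x = x] and [y x y = y] hold for the weak inverse [y] in every field, hence in
    [A], and in [K] they determine [y]. *)
Lemma ring_homV x : g (a_winv x) = (g x)^-1.
Proof.
have xVx : a_mul (a_mul x (a_winv x)) x = x.
  apply: ICM_separated => // F f hf; rewrite !(homE hf).
  by have [->|/mulfV->] := eqVneq (f x : icf_field F) 0; rewrite ?mulr0 ?mul1r.
have VxV : a_mul (a_mul (a_winv x) x) (a_winv x) = a_winv x.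
  apply: ICM_separated => // F f hf; rewrite !(homE hf).
  have [->|/mulVf->] := eqVneq (f x : icf_field F) 0; last by rewrite mul1r.
  by rewrite invr0 mulr0.
have [x0|x0] := eqVneq (g x) 0.
  by rewrite -VxV !gM x0 mulr0 mul0r invr0.
apply: (mulfI x0); rewrite divff//; apply: (mulIf x0).
by rewrite mul1r -!gM xVx.
Qed.

Lemma ring_hom_nat n : g (a_nat A n) = n%:R.
Proof. by elim: n => [|n IHn]; rewrite ?ring_hom0// /a_nat iterS gD g1 IHn mulrS. Qed.

Lemma ring_hom_exp x n : g (a_exp x n) = g x ^+ n.
Proof. by elim: n => [//|n IHn]; rewrite /a_exp iterS gM IHn exprS. Qed.
End RingHom.

Section Roots.
Variables (A : Alg) (p : nat) (x : A).
Hypotheses (AICM : ICM A) (p_prime : prime p).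

Let root_cases (F : ICField) (f : A -> field_alg F) : is_hom f ->
  let fr : icf_field F := f (a_root p x) in
  (p%:R = 0 :> icf_field F /\ fr ^+ p = f x) \/ (p%:R != 0 :> icf_field F /\ fr = 0).
Proof.
move=> hf fr; rewrite {}/fr (homR hf)//.
have [pF|pF] := boolP (p \in [pchar (icf_field F)]).
  by left; rewrite icf_root_char// (pcharf0 pF).
right; rewrite icf_root_other//; split=> //.
by apply: contra pF => p0; rewrite inE p_prime.
Qed.

(** The product of the numeral [p] and its weak inverse is 0 in fields of characteristic [p] and 1
    in all others, so the right-hand side is [x] in the former and 0 in the latter. *)
Lemma a_root_exp : a_exp (a_root p x) p =
  a_add x (a_opp (a_mul (a_mul (a_nat A p) (a_winv (a_nat A p))) x)).
Proof.
apply: ICM_separated => // F f hf; have hr := is_hom_ring_hom hf.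
rewrite (ring_hom_exp hr) !(homE hf) (ring_hom_nat AICM hr).
have [[-> ->]|[p0 ->]] := root_cases hf; first by rewrite !mul0r subr0.
by rewrite divff// mul1r subrr expr0n; case: p p_prime.
Qed.

(** In each field either [p] or the weak root vanishes. Away from characteristic [p] this forces the
    root to map to 0. *)
Lemma a_nat_root : a_mul (a_nat A p) (a_root p x) = a_zero A.
Proof.
apply: ICM_separated => // F f hf; have hr := is_hom_ring_hom hf.
rewrite !(homE hf) (ring_hom_nat AICM hr).
by have [[-> _]|[_ ->]] := root_cases hf; rewrite ?mul0r ?mulr0.
Qed.

Lemma ring_hom_root_char (K : fieldType) (g : A -> K) :
  ring_hom g -> p \in [pchar K] -> g (a_root p x) ^+ p = g x.
Proof.
move=> hg pK; rewrite -ring_hom_exp// a_root_exp.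
have [gD gM _] := hg; rewrite gD ring_homN// !gM ring_hom_nat// (pcharf0 pK).
by rewrite !mul0r subr0.
Qed.

Lemma ring_hom_root_other (K : fieldType) (g : A -> K) :
  ring_hom g -> p \notin [pchar K] -> g (a_root p x) = 0.
Proof.
move=> hg pK; have [_ gM _] := hg.
have p0 : p%:R != 0 :> K by apply: contra pK => p0; rewrite inE p_prime.
by apply: (mulfI p0); rewrite mulr0 -(ring_hom_nat AICM hg) -gM a_nat_root ring_hom0.
Qed.
End Roots.

Lemma ring_hom_is_hom (A : Alg) (K : ICField) (g : A -> icf_field K) :
  ICM A -> ring_hom g -> is_hom (g : A -> field_alg K).
Proof.
move=> AICM hg; have [gD gM g1] := hg.
do ?split => //=; [exact: ring_homN|exact: ring_hom0|exact: ring_homV|].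
move=> p x p_prime; have [pK|pK] := boolP (p \in [pchar (icf_field K)]).
  (* Frobenius is injective, so it suffices to compare [p]-th powers. *)
  apply: (fmorph_inj (pFrobenius_aut pK)); rewrite /= !pFrobenius_autE.
  by rewrite icf_root_char//; apply: ring_hom_root_char.
by rewrite icf_root_other//; apply: ring_hom_root_other.
Qed.

Definition choose_root (K : fieldType) p (a : K) : K :=
  if p \in [pchar K] then xget 0 [set b | b ^+ p = a] else 0.

(** Transparent, so that maps into [K] are also maps into the algebra built on it. *)
Definition icfield_of (K : fieldType) (wr : weakly_rooted K) : ICField.
refine (@Build_ICField K (@choose_root K) wr _ _) => p a p_prime pK.
  rewrite /choose_root pK.
  have [p0|[q [qK rootq]]] := wr; first by rewrite p0 in pK.
  have /eqP-> : p == q by have := pcharf_eq qK p; rewrite pK inE.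
  exact: (xgetPex 0 (rootq a)).
by rewrite /choose_root (negbTE pK).
Defined.

(** * Extending [phi] to an [A]-linear map on [C] *)

Definition linear_over (A C : Alg) (K : fieldType) (h : A -> C) (phi : A -> K)
    (v : C -> K) : Prop :=
  (forall c d, v (a_add c d) = v c + v d) /\
  (forall a c, v (a_mul (h a) c) = phi a * v c).

(** Partial [A]-linear maps are encoded as graphs, so that extension is inclusion and the join of a
    chain is its union. *)
Definition linear_graph (A C : Alg) (K : fieldType) (h : A -> C) (phi : A -> K)
    (X : set (C * K)) : Prop :=
  [/\ forall c x y, X (c, x) -> X (c, y) -> x = y,
      forall c d x y, X (c, x) -> X (d, y) -> X (a_add c d, x + y) &
      forall a c x, X (c, x) -> X (a_mul (h a) c, phi a * x)].

Section LinearFunctional.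
Variables (A C : Alg) (F : ICField) (h : A -> C) (phi : A -> field_alg F).
Hypotheses (CICM : ICM C) (h_emb : embedding h) (hphi : is_hom phi).
Let K : fieldType := icf_field F.
Let hh := h_emb.1.

Let hD x y : h (a_add x y) = a_add (h x) (h y). Proof. exact: hh.1. Qed.
Let hM x y : h (a_mul x y) = a_mul (h x) (h y). Proof. exact: hh.2.1. Qed.
Let hN x : h (a_opp x) = a_opp (h x). Proof. exact: hh.2.2.1. Qed.
Let h0 : h (a_zero A) = a_zero C. Proof. exact: hh.2.2.2.1. Qed.
Let h1 : h (a_one A) = a_one C. Proof. exact: hh.2.2.2.2.1. Qed.
Let hV x : h (a_winv x) = a_winv (h x). Proof. exact: hh.2.2.2.2.2.1. Qed.
Let hE := (hD, hM, hN, h0, h1, hV).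

(* [K] is injective as an [A]-module: the values already forced on the ideal
   [{a | a c \in dom X}] come from a single prospective value at [c]. *)
Lemma linear_graph_value (X : set (C * K)) (c : C) :
  linear_graph h (phi : A -> K) X ->
  exists t : K, forall a x, X (a_mul (h a) c, x) -> x = (phi a : K) * t.
Proof.
move=> [Xfun XD XM].
have [[a0 [y0 [Xa0 p0]]]|none] := pselect (exists a0 (y0 : K),
    X (a_mul (h a0) c, y0) /\ (phi a0 : K) != 0).
  (* A scalar with nonzero image that brings [c] into the domain forces the value at [c]. *)
  exists (y0 / (phi a0 : K)) => a x Xa.
  suff E : (phi a0 : K) * x = (phi a : K) * y0.
    by rewrite mulrA -E mulrAC mulfV// mul1r.
  have := XM a _ _ Xa0; have := XM a0 _ _ Xa.
  rewrite (_ : a_mul (h a0) (a_mul _ _) = a_mul (h a) (a_mul (h a0) c)).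
    exact: Xfun.
  by apply: ICM_separated => // G f hf; rewrite !(homE hf) mulrCA.
exists 0 => a x Xa; rewrite mulr0.
have pa0 : phi a = 0 :> K.
  by apply: contrapT => /eqP pa; apply: none; exists a, x.
(* The product of [a] and its weak inverse fixes [a c], while [phi] sends it to 0; hence [x = 0]. *)
have := XM (a_mul a (a_winv a)) _ _ Xa.
rewrite (homM hphi) pa0 !mul0r; apply: Xfun.
rewrite (_ : a_mul _ _ = a_mul (h a) c)//.
apply: ICM_separated => // G f hf; rewrite !hE !(homE hf).
have [->|/mulfV->] := eqVneq (f (h a) : icf_field G) 0; last by rewrite mul1r.
by rewrite !mul0r.
Qed.

(** A maximal graph above that of [phi] on the image of [h] is total, since [linear_graph_value]
    extends it by any further point. Injectivity of [h] makes the initial graph functional. *)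
Lemma exists_linear_over :
  exists v : C -> K, linear_over h (phi : A -> K) v /\ v (a_one C) = 1.
Proof.
pose X0 : set (C * K) := [set z | exists a, z = (h a, phi a)].
have [||X [[Xfun XD XM] X0X Xmax]] :=
  @Zorn_above _ (linear_graph h (phi : A -> K)) X0.
- split=> [c x y [a [-> ->]] [b [/h_emb.2 -> ->]]//|
           c d x y [a [-> ->]] [b [-> ->]]|a c x [b [-> ->]]].
    by exists (a_add a b); rewrite hE (homE hphi).
  by exists (a_mul a b); rewrite hE (homE hphi).
- move=> G _ Glin Gtot.
  have join X Y : G X -> G Y -> exists Z, [/\ G Z, X `<=` Z & Y `<=` Z].
    by move=> GX GY; have [XY|YX] := Gtot _ _ GX GY; [exists Y|exists X]; split.
  split=> [c x y [X GX Xx] [Y GY Yy]|c d x y [X GX Xx] [Y GY Yy]|a c x [X GX Xx]].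
  + have [Z [GZ XZ YZ]] := join _ _ GX GY.
    by have [Zfun _ _] := Glin _ GZ; apply: (Zfun c); auto.
  + have [Z [GZ XZ YZ]] := join _ _ GX GY.
    by have [_ ZD _] := Glin _ GZ; exists Z => //; apply: ZD; auto.
  + by have [_ _ XM] := Glin _ GX; exists X => //; apply: XM.
have X00 : X (a_zero C, 0).
  by apply: X0X; exists (a_zero A); rewrite h0 (hom0 hphi).
have Xtot c : exists x, X (c, x).
  have [t tP] := @linear_graph_value X c (And3 Xfun XD XM).
  exists t.
  (* The extension of [X] generated by the value [t] at [c]. *)
  pose Y : set (C * K) := [set z | exists s y a, X (s, y) /\
    z = (a_add s (a_mul (h a) c), y + (phi a : K) * t)].
  apply: (Xmax Y) => [|[s y] Xs|].
  - split=> [d x1 x2 [s1 [y1 [a1 [X1 [-> ->]]]]] [s2 [y2 [a2 [X2 [E ->]]]]]|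
             d1 d2 x1 x2 [s1 [y1 [a1 [X1 [-> ->]]]]] [s2 [y2 [a2 [X2 [-> ->]]]]]|
             a d x [s [y [b [Xs [-> ->]]]]]].
    (* If [s1 + a1 c = s2 + a2 c], then [(a2 - a1) c = s1 - s2] lies in the domain with value
       [y1 - y2], which [tP] equates with the multiple of [t]. *)
    + have XN : X (a_add s1 (a_mul (h (a_opp (a_one A))) s2),
                   y1 + (phi (a_opp (a_one A)) : K) * y2).
        by apply: XD => //; apply: XM.
      have := tP (a_add a2 (a_opp a1)) (y1 - y2).
      rewrite !(homE hphi) => H; apply/eqP; rewrite -subr_eq0; apply/eqP.
      rewrite [LHS](_ : _ = y1 - y2 - ((phi a2 : K) - phi a1) * t); last by ring.
      rewrite {}H ?subrr//; move: XN; rewrite !(homE hphi) mulN1r.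
      congr (X (_, _)); apply: ICM_separated => // G f hf.
      have := congr1 f E; rewrite !hE !(homE hf) => Ef.
      set u := (f s1 : icf_field G) in Ef *; set w := (f s2 : icf_field G) in Ef *.
      have -> : u = w + (f (h a2) : icf_field G) * f c - (f (h a1) : icf_field G) * f c.
        by rewrite -Ef addrK.
      by ring.
    + exists (a_add s1 s2), (y1 + y2), (a_add a1 a2); split; first exact: XD.
      congr (_, _); last by rewrite (homE hphi); ring.
      by apply: ICM_separated => // G f hf; rewrite !hE !(homE hf); ring.
    + exists (a_mul (h a) s), ((phi a : K) * y), (a_mul a b); split; first exact: XM.
      congr (_, _); last by rewrite (homE hphi); ring.
      by apply: ICM_separated => // G f hf; rewrite !hE !(homE hf); ring.
  - exists s, y, (a_zero A); split=> //.
    congr (_, _); last by rewrite (homE hphi); ring.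
    by apply: ICM_separated => // G f hf; rewrite !hE !(homE hf); ring.
  - exists (a_zero C), 0, (a_one A); split=> //.
    congr (_, _); last by rewrite (homE hphi); ring.
    by apply: ICM_separated => // G f hf; rewrite !hE !(homE hf); ring.
have [v vP] := choice Xtot; exists v; split; first split.
- by move=> c d; apply: Xfun (vP _) (XD _ _ _ _ (vP _) (vP _)).
- by move=> a c; apply: Xfun (vP _) (XM _ _ _ (vP _)).
- by apply: Xfun (vP _) _; apply: X0X; exists (a_one A); rewrite h1 (hom1 hphi).
Qed.
End LinearFunctional.

(** * The operators generated by [K] and [C] *)

(** Formal names of operators, identified later when they act alike. Opposites are products with the
    scalar -1. *)
Inductive term (K : fieldType) (C : Alg) : Type :=
| TK of K
| TC of C
| TAdd of term K C & term K C
| TMul of term K C & term K C.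
Arguments TK {K} C.
Arguments TC K {C}.

(* The action of [K (x) C] on functions [C -> K]: post-multiplication by [K]
   and pre-multiplication by [C]. *)
Fixpoint eval (K : fieldType) (C : Alg) (t : term K C) (v : C -> K) : C -> K :=
  match t with
  | TK x => fun c => x * v c
  | TC d => fun c => v (a_mul d c)
  | TAdd s t => fun c => eval s v c + eval t v c
  | TMul s t => eval s (eval t v)
  end.

Section Eval.
Variables (K : fieldType) (C : Alg).
Implicit Types (t : term K C) (v w : C -> K).

Lemma evalD t v w c :
  eval t (fun d => v d + w d) c = eval t v c + eval t w c.
Proof.
elim: t v w c => [x|d|s IHs t IHt|s IHs t IHt] v w c /=; rewrite ?mulrDr//.
  by rewrite IHs IHt addrACA.
rewrite -IHs; congr (eval s _ c); apply/funext => d; exact: IHt.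
Qed.

Lemma evalZ t x v c : eval t (fun d => x * v d) c = x * eval t v c.
Proof.
elim: t v c => [y|d|s IHs t IHt|s IHs t IHt] v c //=; first by rewrite mulrCA.
  by rewrite IHs IHt mulrDr.
rewrite -IHs; congr (eval s _ c); apply/funext => d; exact: IHt.
Qed.

Hypothesis CICM : ICM C.

(** It suffices that generators commute with every operator: scalars by [evalZ], and elements of [C]
    by [key], which rests on commutativity in [C]. *)
Lemma eval_comm s t v c : eval s (eval t v) c = eval t (eval s v) c.
Proof.
have key d : forall v c, eval t v (a_mul d c) = eval t (fun b => v (a_mul d b)) c.
  elim: t => [y|b|t1 IH1 t2 IH2|t1 IH1 t2 IH2] {}v {}c //=.
  - congr (v _); apply: ICM_separated => // G f hf.
    by rewrite !(homE hf) mulrCA.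
  - by rewrite IH1 IH2.
  - by rewrite IH1; congr (eval t1 _ c); apply/funext => b; rewrite IH2.
elim: s v c => [y|d|s1 IH1 s2 IH2|s1 IH1 s2 IH2] v c //=.
- by rewrite evalZ.
- by rewrite evalD IH1 IH2.
- rewrite -IH1; congr (eval s1 _ c); apply/funext => b; exact: IH2.
Qed.
End Eval.

(** * A residue field of the operator ring *)

Section Amalgam.
Variables (A C : Alg) (F : ICField) (h : A -> C) (phi : A -> field_alg F).
Hypotheses (CICM : ICM C) (h_emb : embedding h) (hphi : is_hom phi).
Let K : fieldType := icf_field F.
Let lin (v : C -> K) := linear_over h (phi : A -> K) v.
Local Notation T := (term K C).

(** Terms are compared on [A]-linear maps only, so products respect the comparison once operators
    preserve these maps. *)
Let lin_eval (t : T) v : lin v -> lin (eval t v).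
Proof.
elim: t v => [x|d|s IHs t IHt|s IHs t IHt] v [vD vM]; split=> *; rewrite /=.
- by rewrite vD mulrDr.
- by rewrite vM mulrCA.
- by rewrite -vD; congr v; apply: ICM_separated => // G f hf; rewrite !(homE hf) mulrDr.
- by rewrite -vM; congr v; apply: ICM_separated => // G f hf; rewrite !(homE hf) mulrCA.
- by rewrite (IHs v _).1// (IHt v _).1// addrACA.
- by rewrite (IHs v _).2// (IHt v _).2// mulrDr.
- by rewrite (IHs _ (IHt v _)).1.
- by rewrite (IHs _ (IHt v _)).2.
Qed.

(** On [A]-linear maps the actions of [phi a] and [h a] coincide; this restriction glues [K] and [C]
    along [A]. *)
Definition eqv (s t : T) := forall v, lin v -> forall c, eval s v c = eval t v c.

(** Proper ideals of terms modulo [eqv]; saturation under [eqv] is built into the closure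
    clauses. *)
Definition term_ideal (I : set T) : Prop :=
  [/\ I (TK C 0),
      forall r s t, I s -> I t -> eqv r (TAdd s t) -> I r,
      forall r s t, I t -> eqv r (TMul s t) -> I r &
      ~ I (TK C 1)].

Let opp (t : T) := TMul (TK C (-1)) t.

Let eqv_refl s : eqv s s. Proof. by []. Qed.

Let eqv_mul s s' t t' : eqv s s' -> eqv t t' -> eqv (TMul s t) (TMul s' t').
Proof.
move=> ss tt v lv c /=; rewrite ss; last exact: lin_eval.
by congr (eval s' _ c); apply/funext => d; apply: tt.
Qed.

Lemma exists_maximal_ideal : exists M, term_ideal M /\
  forall B, term_ideal B -> M `<=` B -> B `<=` M.
Proof.
have [||M [MI _ Mmax]] := @Zorn_above _ term_ideal [set t | eqv t (TK C 0)];
  last by exists M.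
- split=> //= [r s t s0 t0 E|r s t t0 E|].
  + by move=> v lv c; rewrite E//= s0// t0//= !mul0r addr0.
  + move=> v lv c; rewrite E// (eqv_mul (eqv_refl s) t0)//=.
    by rewrite evalZ !mul0r.
  (* The zero ideal is proper: the identity operator does not kill a map with value 1 at 1. *)
  + have [v [lv v1]] := exists_linear_over CICM h_emb hphi.
    move=> /(_ v lv (a_one C)) /=; rewrite v1 mul1r mul0r.
    by move/eqP; rewrite oner_eq0.
- move=> G G0 Gid Gtot.
  have join X Y : G X -> G Y -> exists Z, [/\ G Z, X `<=` Z & Y `<=` Z].
    by move=> GX GY; have [XY|YX] := Gtot _ _ GX GY; [exists Y|exists X]; split.
  split=> [|r s t [X GX Xs] [Y GY Yt] E|r s t [X GX Xt] E|[X GX]].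
  + by eexists; first exact: G0.
  + have [Z [GZ XZ YZ]] := join _ _ GX GY.
    by have [_ ZD _ _] := Gid _ GZ; exists Z => //; apply: ZD E; auto.
  + by have [_ _ XM _] := Gid _ GX; exists X => //; apply: XM E.
  + by have [] := Gid _ GX.
Qed.

Lemma ideal_field_congruence (M : set T) : term_ideal M ->
  (forall B, term_ideal B -> M `<=` B -> B `<=` M) ->
  field_congruence (TK C 0) (TK C 1) (@TAdd K C) (@TMul K C) opp
    (fun s t => M (TAdd s (opp t))).
Proof.
move=> [M0 MD MM M1] Mmax.
have eqvM s t : eqv s t -> M (TAdd s (opp t)).
  by move=> E; apply: (MM _ (TK C 0) _ M0) => v lv c; rewrite /= E//; ring.
split.
- by move=> x; apply: eqvM.
- by move=> x y xy; apply: (MM _ (TK C (-1)) _ xy) => v lv c /=; ring.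
- by move=> x y z xy yz; apply: (MD _ _ _ xy yz) => v lv c /=; ring.
- by move=> x x' y y' xx yy; apply: (MD _ _ _ xx yy) => v lv c /=; ring.
- move=> x x' y y' xx yy.
  (* The identity used is [x y - x' y' = y (x - x') + x' (y - y')]. *)
  apply: (MD _ (TMul y (TAdd x (opp x'))) (TMul x' (TAdd y (opp y')))).
  + exact: MM xx _.
  + exact: MM yy _.
  + move=> v lv c /=; rewrite !evalD !evalZ (eval_comm CICM y x).
    by rewrite (eval_comm CICM y x'); ring.
- by move=> x y z; apply: eqvM => v lv c /=; ring.
- by move=> x y; apply: eqvM => v lv c /=; ring.
- by move=> x; apply: eqvM => v lv c /=; ring.
- by move=> x; apply: eqvM => v lv c /=; ring.
- by move=> x y z; apply: eqvM.
- by move=> x y; apply: eqvM => v lv c /=; rewrite eval_comm.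
- by move=> x; apply: eqvM => v lv c /=; ring.
- by move=> x y z; apply: eqvM => v lv c /=.
- by move=> H; apply: M1; apply: (MM _ (TK C 1) _ H) => v lv c /=; ring.
- move=> x x0.
  (* The ideal generated by [M] and [x]. If it contains 1, then [x] is invertible modulo [M];
     otherwise maximality puts [x] in [M]. *)
  pose B : set T := [set t | exists m y, M m /\ eqv t (TAdd m (TMul y x))].
  have [[m [y [Mm E]]]|B1] := pselect (B (TK C 1)).
    exists y; apply: (MM _ (TK C (-1)) _ Mm) => v lv c /=.
    by have /= := E v lv c => ->; ring.
  case: x0; have Mx : M x.
    apply: (Mmax B).
    - split=> //.
      + by exists (TK C 0), (TK C 0); split=> // v lv c /=; ring.
      + move=> r s t [m [y [Mm E]]] [m' [y' [Mm' E']]] Er.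
        exists (TAdd m m'), (TAdd y y'); split; first exact: MD Mm Mm' _.
        by move=> v lv c; rewrite Er//= E// E'//=; ring.
      + move=> r s t [m [y [Mm E]]] Er.
        exists (TMul s m), (TMul s y); split; first exact: MM Mm _.
        move=> v lv c; rewrite Er// (eqv_mul (eqv_refl s) E)//=.
        by rewrite evalD.
    - move=> m Mm; exists m, (TK C 0); split=> // v lv c /=; ring.
    - by exists (TK C 0), (TK C 1); split=> // v lv c /=; ring.
  by apply: (MM _ (TK C 1) _ Mx) => v lv c /=; ring.
Qed.

(** The last clause is an induction principle: sums and products of the two images exhaust [L]. It
    serves to find [p]-th roots. *)
Lemma amalgam_field : exists (L : fieldType) (u : field_alg F -> L) (g : C -> L),
  [/\ ring_hom u, ring_hom g, forall a, u (phi a) = g (h a) &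
      forall P : L -> Prop, (forall x, P (u x)) -> (forall c, P (g c)) ->
        (forall k l, P k -> P l -> P (k + l)) ->
        (forall k l, P k -> P l -> P (k * l)) -> forall k, P k].
Proof.
have [M [MI Mmax]] := exists_maximal_ideal.
have congM := ideal_field_congruence MI Mmax.
have [L [pi [piS piE piD piM pi1]]] := field_congruence_quotient congM.
have [M0 _ MM _] := MI.
have piV s t : eqv s t -> pi s = pi t.
  move=> E; apply: piE; apply: (MM _ (TK C 0) _ M0) => v lv c.
  by rewrite /= E//; ring.
exists L, (fun x => pi (TK C (x : K))), (fun c => pi (TC K c)); split.
- split=> [x y|x y|//]; rewrite -?piD -?piM; apply: piV => v lv c /=; ring.
- split=> [x y|x y|]; rewrite -?piD -?piM -?pi1; apply: piV => v lv c /=.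
  + rewrite -lv.1; congr v; apply: ICM_separated => // G f hf.
    by rewrite !(homE hf); ring.
  + congr v; apply: ICM_separated => // G f hf.
    by rewrite !(homE hf); ring.
  + rewrite mul1r; congr v; apply: ICM_separated => // G f hf.
    by rewrite !(homE hf); ring.
- by move=> a; apply: piV => v lv c /=; rewrite lv.2.
- move=> P PF PC PD PM k; have [t <-] := piS k.
  elim: t => [x|c|s IHs t IHt|s IHs t IHt]; [exact: PF|exact: PC| |].
    by rewrite piD; apply: PD.
  by rewrite piM; apply: PM.
Qed.

Lemma amalgam_icfield :
  exists (L : ICField) (u : field_alg F -> field_alg L) (g : C -> field_alg L),
  [/\ is_hom u, is_hom g, injective u & forall a, u (phi a) = g (h a)].
Proof.
have [L [u [g [hu hg ug gen]]]] := amalgam_field.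
have wr : weakly_rooted L.
  have [[p pL]|none] := pselect (exists p, p \in [pchar L]); last first.
    by left=> p; apply/negP => pL; apply: none; exists p.
  have p_prime := pcharf_prime pL.
  (* The [p]-th powers contain both images and are closed under products and, by Frobenius, under
     sums. *)
  right; exists p; split=> //; apply: gen.
  - by move=> x; exists (u (a_root p x)); apply: (ring_hom_root_char _ (ICM_field F)).
  - by move=> c; exists (g (a_root p c)); apply: ring_hom_root_char.
  - move=> k l [a <-] [b <-]; exists (a + b).
    by rewrite -!(pFrobenius_autE pL) rmorphD.
  - by move=> k l [a <-] [b <-]; exists (a * b); rewrite exprMn.
exists (icfield_of wr), u, g; split=> //.
- by apply: ring_hom_is_hom => //; apply: ICM_field.
- exact: ring_hom_is_hom.
(* If [x - y] were nonzero, its image 0 would be invertible. *)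
- move=> x y uxy; apply/eqP; rewrite -subr_eq0; apply/negPn/negP => xy0.
  have [uD uM u1] := hu.
  have := uM ((x : K) - y) ((x : K) - y)^-1; rewrite /= mulfV// u1.
  rewrite uD (ring_homN (ICM_field F) hu y) uxy subrr mul0r.
  by move/eqP; rewrite oner_eq0.
Qed.
End Amalgam.

(** * The amalgam as a product *)

(** This provides one factor of the amalgam. A map from [B] to a field separating [x] and [y] is
    followed by the injective [u], so separation survives. *)
Lemma separating_amalgam (A B C : Alg) (h1 : A -> B) (h2 : A -> C) (x y : B) :
  ICM B -> ICM C -> is_hom h1 -> embedding h2 -> x <> y ->
  exists (L : ICField) (f : B -> field_alg L) (g : C -> field_alg L),
  [/\ is_hom f, is_hom g, forall a, f (h1 a) = g (h2 a) & f x <> f y].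
Proof.
move=> BICM CICM hh1 eh2 xy.
have [F [f [hf fxy]]] : exists (F : ICField) (f : B -> field_alg F),
    is_hom f /\ f x <> f y.
  apply: contrapT => none; apply: xy; apply: ICM_separated => // F f hf.
  by apply: contrapT => fxy; apply: none; exists F, f.
have [L [u [g [hu hg u_inj ug]]]] :=
  amalgam_icfield CICM eh2 (is_hom_comp hh1 hf).
exists L, (u \o f), g; split=> //; first exact: is_hom_comp hf hu.
by move=> /u_inj.
Qed.

Theorem mainTheorem6 :
  forall (A B C : Alg), ICM A -> ICM B -> ICM C ->
  forall (h1 : A -> B) (h2 : A -> C), embedding h1 -> embedding h2 ->
  exists (D : Alg), ICM D /\
    exists (g1 : B -> D) (g2 : C -> D),
      embedding g1 /\ embedding g2 /\ (forall a : A, g1 (h1 a) = g2 (h2 a)).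
Proof.
move=> A B C _ BICM CICM h1 h2 e1 e2.
pose separates (i : B * B + C * C) (L : ICField)
    (f : B -> field_alg L) (g : C -> field_alg L) := match i with
  | inl (x, y) => f x <> f y
  | inr (x, y) => g x <> g y
  end.
(* The factors are indexed by the pairs of distinct points of [B] or of [C], which makes both maps
   injective. *)
pose I := {i : B * B + C * C | match i with
  | inl (x, y) => x <> y | inr (x, y) => x <> y end}.
have sep (i : I) : exists S : {L : ICField &
      ((B -> field_alg L) * (C -> field_alg L))%type},
    [/\ is_hom (projT2 S).1, is_hom (projT2 S).2,
        forall a, (projT2 S).1 (h1 a) = (projT2 S).2 (h2 a) &
        separates (sval i) _ (projT2 S).1 (projT2 S).2].
  case: i => -[[x y] xy|[x y] xy].
    have [L [f [g [hf hg fg fxy]]]] :=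
      separating_amalgam BICM CICM e1.1 e2 xy.
    by exists (existT _ L (f, g)); split.
  (* The same lemma with the roles of [B] and [C] exchanged. *)
  have [L [g [f [hg hf gf gxy]]]] :=
    separating_amalgam CICM BICM e2.1 e1 xy.
  by exists (existT _ L (f, g)); split.
have [S SP] := choice sep.
pose Fd (i : I) := projT1 (S i).
exists (prod_alg Fd); split; first exact: ICM_prod.
exists (fun b i => (projT2 (S i)).1 b), (fun c i => (projT2 (S i)).2 c).
split; [split|split; [split|]].
- by apply: (@is_hom_prod I Fd B (fun i => (projT2 (S i)).1)) => i; have [] := SP i.
- move=> x y E; apply: contrapT => xy.
  have [_ _ _] := SP (exist _ (inl (x, y)) xy); apply.
  exact: (congr1 (fun f => f (exist _ (inl (x, y)) xy)) E).
- by apply: (@is_hom_prod I Fd C (fun i => (projT2 (S i)).2)) => i; have [] := SP i.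
- move=> x y E; apply: contrapT => xy.
  have [_ _ _] := SP (exist _ (inr (x, y)) xy); apply.
  exact: (congr1 (fun f => f (exist _ (inr (x, y)) xy)) E).
- by move=> a; apply: functional_extensionality_dep => i; have [] := SP i.
Qed.
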